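(* Let $\lambda_1,\lambda_2,\mu>0$ with $\lambda_2<\mu$, and let $B$ be a finite number with $B\ge \lambda_1+\lambda_2+\mu$. For any policy $\pi$, the exponentially uniformized Markov decision process with uniformization parameter $B$, controlled by $\pi$, and the continuous time Markov decision process with a drift, controlled by $\pi$, are stochastically equivalent.
   Context: State space: $S=\mathbb{N}_0\times\mathbb{N}_0\times[0,\infty)$. A state $(i,j,t)$ means that $i$ queries and $j$ reports are present in a wireless sensor network (WSN) and that $t$ is the time elapsed since the last report completion (the age of the data stored in a database, DB). Actions: $D=\{DB,WSN\}$. An action is taken at each query arrival. Policy: a map $\pi:S\to D$. If the state just before a query arrival is $(i,j,t)$, the action taken is $d=\pi(i,j,t)$. It is assumed throughout that every policy is left-continuous in the age component $t$. Put $\phi_1(i,j)=\frac{i}{i+j}$ and $\phi_2(i,j)=\frac{j}{i+j}$ for $i+j>0$ (processor sharing service). Continuous time Markov decision process (CTMDP) with a drift, under $\pi$: the continuous-time process on $S$ in which, between jumps, $i$ and $j$ stay constant while the age $t$ increases deterministically at unit rate. When the current state is $(i,j,t)$ and $d=\pi(i,j,t)$, transitions occur at the following rates: - to $(i+1,j,t)$ at rate $\lambda_1$ if $d=WSN$; - to $(i,j,t)$ (no change of state) at rate $\lambda_1$ if $d=DB$; - to $(i,j+1,t)$ at rate $\lambda_2$; - to $(i-1,j,t)$ at rate $\mu\phi_1(i,j)$ if $i>0$; - to $(i,j-1,0)$ at rate $\mu\phi_2(i,j)$ if $j>0$. Exponentially uniformized Markov decision process, under $\pi$: the continuous-time process on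 $S$ in which transition epochs are separated by independent exponential times with parameter $B$. Between transition epochs, $i$ and $j$ stay constant and the age increases at unit rate. If the state just after a transition epoch (or at the initial time) is $(i,j,t)$ and the exponential time until the next transition epoch takes the value $s$, so that the state just before this next epoch is $(i,j,t+s)$, then with $d=\pi(i,j,t+s)$ the new state is - $(i+1,j,t+s)$ with probability $\lambda_1B^{-1}$ if $d=WSN$; - $(i,j,t+s)$ with probability $\lambda_1B^{-1}$ if $d=DB$ (query arrival assigned to the DB); - $(i,j+1,t+s)$ with probability $\lambda_2B^{-1}$; - $(i-1,j,t+s)$ with probability $\mu B^{-1}\phi_1(i,j)$ if $i>0$; - $(i,j-1,0)$ with probability $\mu B^{-1}\phi_2(i,j)$ if $j>0$; - $(i,j,t+s)$ with probability $1-(\lambda_1+\lambda_2+\mu\mathbf{1}_{\{i+j>0\}})B^{-1}$ (dummy transition). Stochastically equivalent: the two controlled continuous-time Markov processes have the same probabilistic dynamics, i.e. for every common initial state in $S$ they have the same finite-dimensional distributions as $S$-valued processes. *)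

(* Defs.v *)
From HB Require Import structures.
From mathcomp Require Import all_boot all_order all_algebra.
From mathcomp Require Import all_classical all_reals all_analysis.
Import Order.TTheory GRing.Theory Num.Theory.
Import numFieldNormedType.Exports.

Set Implicit Arguments.
Unset Strict Implicit.
Unset Printing Implicit Defensive.

Local Open Scope classical_set_scope.
Local Open Scope ring_scope.

(* [(i, j, t)]: [i] queries, [j] reports, age [t]. The state space is the part
   [in_S] with nonnegative age; the carrier type is kept to [R] so that the
   library's product sigma-algebra applies. *)
Notation state R := (nat * nat * R)%type.

Definition in_S (R : realType) (x : state R) : Prop := 0 <= x.2.

Inductive action := DB | WSN.

(* Values of a policy outside [in_S] are never used. *)
Definition policy (R : realType) : Type := state R -> action.

(* [action] is discrete, so left-continuity means being constant on some
   interval [(t - e, t]]. At [t = 0] there is no condition. *)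
Definition left_continuous (R : realType) (pi : policy R) : Prop :=
  forall (i j : nat) (t : R), 0 < t ->
    \forall s \near t^'-, pi (i, j, s) = pi (i, j, t).

Definition flow (R : realType) (x : state R) (s : R) : state R :=
  (x.1, x.2 + s).

Definition phi1 (R : realType) (i j : nat) : R := i%:R / (i + j)%:R.
Definition phi2 (R : realType) (i j : nat) : R := j%:R / (i + j)%:R.
Arguments phi1 {R} i j.
Arguments phi2 {R} i j.

(* Pairs (rate, target) of the transitions out of [x]; a transition that is
   not available in [x] is listed with rate 0. A query sent to the DB is a
   transition (of rate [lambda1]) that leaves the state unchanged. *)
Definition ctmdp_rates (R : realType) (lambda1 lambda2 mu : R) (pi : policy R)
    (x : state R) : seq (R * state R) :=
  let: (i, j, t) := x in
  [:: (if pi x is WSN then lambda1 else 0, (i.+1, j, t));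
      (if pi x is DB then lambda1 else 0, (i, j, t));
      (lambda2, (i, j.+1, t));
      (if (0 < i)%N then mu * phi1 i j else 0, (i.-1, j, t));
      (if (0 < j)%N then mu * phi2 i j else 0, (i, j.-1, 0))].

(* Pairs (probability, target), [x] being the state just before the epoch. *)
Definition unif_probs (R : realType) (lambda1 lambda2 mu B : R) (pi : policy R)
    (x : state R) : seq (R * state R) :=
  let: (i, j, t) := x in
  [:: (if pi x is WSN then lambda1 / B else 0, (i.+1, j, t));
      (if pi x is DB then lambda1 / B else 0, (i, j, t));
      (lambda2 / B, (i, j.+1, t));
      (if (0 < i)%N then mu / B * phi1 i j else 0, (i.-1, j, t));
      (if (0 < j)%N then mu / B * phi2 i j else 0, (i, j.-1, 0));
      (1 - (lambda1 + lambda2 + (if (0 < i + j)%N then mu else 0)) / B,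
       (i, j, t))].

Definition mass (R : realType) (T : Type) (l : seq (R * T)) (A : set T) : R :=
  \sum_(p <- l) p.1 * \1_A p.2.

(* [K x C]: probability that the pair (time until the next epoch, state just
   after it) lies in [C] when the state just after the current epoch is [x]. *)
Definition epoch_kernel (R : realType) : Type :=
  state R -> set (R * state R) -> \bar R.

(* Transitions at rates [rates], along the drift: the first one occurs after
   time [s] with probability [exp (- int_0^s total_rate (flow x u) du)], and the
   one with rate [p.1] occurs in [[s, s + ds]] with density
   [p.1 * exp (- int_0^s total_rate (flow x u) du)]. *)
Definition total_rate (R : realType) (l : seq (R * state R)) : R :=
  \sum_(p <- l) p.1.

Definition rate_kernel (R : realType) (rates : state R -> seq (R * state R)) :
    epoch_kernel R := fun x C =>
  (\int[lebesgue_measure]_(s in `[0%R, +oo[)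
     (expR (- \int[lebesgue_measure]_(u in `[0%R, s]) total_rate (rates (flow x u)))
      * mass (rates (flow x s)) [set y | C (s, y)])%:E)%E.

Definition ctmdp (R : realType) (lambda1 lambda2 mu : R) (pi : policy R) :
    epoch_kernel R := rate_kernel (ctmdp_rates lambda1 lambda2 mu pi).

Definition uniformized_mdp (R : realType) (lambda1 lambda2 mu B : R)
    (pi : policy R) : epoch_kernel R := fun x C =>
  (\int[exponential_prob B]_(s in `[0%R, +oo[)
     (mass (unif_probs lambda1 lambda2 mu B pi (flow x s))
           [set y | C (s, y)])%:E)%E.

(* [X] is a process started in [x] whose epochs follow [K]: [Z n] is the state
   just after the [n]-th epoch ([Z 0] the initial state), [T n] the time from
   the [n]-th epoch to the next one, and [K (Z n)] is the conditional law of
   [(T n, Z n.+1)] given the past. [X] is left unspecified after an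
   accumulation point of epochs. *)
Definition is_process (R : realType) (K : epoch_kernel R) (x : state R)
    (d : measure_display) (W : measurableType d) (P : probability W R)
    (X : R -> W -> state R) : Prop :=
  exists (T : nat -> W -> R) (Z : nat -> W -> state R),
    [/\ (forall n, measurable_fun [set: W] (T n) /\ forall w, 0 <= T n w),
        (forall n, measurable_fun [set: W] (Z n) /\ forall w, in_S (Z n w)),
        (forall w, Z 0%N w = x),
        (forall n (E : set W) (C : set (R * state R)),
           g_sigma_preimage
             (fun (k : 'I_n) w => (T k w, Z k.+1 w)) E ->
           measurable C ->
           P (E `&` [set w | C (T n w, Z n.+1 w)]) =
           (\int[P]_(w in E) K (Z n w) C)%E) &
        (forall t : R, 0 <= t ->
           [/\ measurable_fun [set: W] (X t),
               (forall w, in_S (X t w)) &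
               (forall n w, \sum_(k < n) T k w <= t < \sum_(k < n.+1) T k w ->
                  X t w = flow (Z n w) (t - \sum_(k < n) T k w))])].

Definition same_fdd (R : realType)
    (d1 : measure_display) (W1 : measurableType d1) (P1 : probability W1 R)
    (X1 : R -> W1 -> state R)
    (d2 : measure_display) (W2 : measurableType d2) (P2 : probability W2 R)
    (X2 : R -> W2 -> state R) : Prop :=
  forall (n : nat) (t : n.-tuple R), (forall k, 0 <= tnth t k) ->
  forall A : set (n.-tuple (state R)), measurable A ->
    pushforward P1 (fun w => [tuple X1 (tnth t k) w | k < n]) A =
    pushforward P2 (fun w => [tuple X2 (tnth t k) w | k < n]) A.

Definition stochastically_equivalent (R : realType) (K1 K2 : epoch_kernel R) :
    Prop :=
  forall x : state R, in_S x ->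
  forall (d1 : measure_display) (W1 : measurableType d1) (P1 : probability W1 R)
    (X1 : R -> W1 -> state R)
    (d2 : measure_display) (W2 : measurableType d2) (P2 : probability W2 R)
    (X2 : R -> W2 -> state R),
  is_process K1 x P1 X1 -> is_process K2 x P2 X2 -> same_fdd P1 X1 P2 X2.

(* Main.v *)
From HB Require Import structures.
Require Import Defs.
From mathcomp Require Import all_boot all_order all_algebra.
From mathcomp Require Import all_classical all_reals all_analysis.
From mathcomp Require Import measurable_realfun ring.
Import Order.TTheory GRing.Theory Num.Theory.
Import numFieldNormedType.Exports.

(** In both processes, the law of the states observed at fixed times before the
    [m]-th epoch is an [m]-fold iterate of a one-epoch integral operator. The
    total rate [L] of the CTMDP is constant along the drift, and a jump at rate
    [L] is a jump of the process with epochs at rate [B >= L] after a number of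
    dummy epochs; at the level of operators this is the identity
      [int exp(-L s) q(s) ds =
       int exp(-B s) (q(s) + (B - L) int exp(-L u) q(s + u) du) ds].
    It shows that [m] epochs of the uniformized process observe no more than [m]
    epochs of the CTMDP. As [E exp(-S_m) = (B / (B + 1)) ^ m] for the time [S_m]
    of the [m]-th uniformized epoch, the uniformized process does not explode, so
    that each of its finite-dimensional laws is dominated by that of the CTMDP.
    Both being probabilities, they are equal. *)

Set Implicit Arguments.
Unset Strict Implicit.
Unset Printing Implicit Defensive.
Local Open Scope classical_set_scope.
Local Open Scope ring_scope.

(** * Mixtures of weighted deterministic transitions *)

Section mixture.
Context d (O : measurableType d) d' (T : measurableType d') (R : realType).
Local Open Scope ereal_scope.

(** A kernel with mass [weight b x] at the single point [target b x]. Every transition law below is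
    a finite sum of such kernels, so integrals against it are finite sums and measurability concerns
    two maps only. *)
Record branch := Branch {
  weight : O -> R;
  target : O -> T;
  weight_ge0 : forall x, (0 <= weight x)%R;
  measurable_weight : measurable_fun [set: O] weight;
  measurable_target : measurable_fun [set: O] target }.

Definition mixture (bs : seq branch) (F : T -> \bar R) (x : O) : \bar R :=
  \sum_(b <- bs) (weight b x)%:E * F (target b x).

Lemma mixture_term_ge0 (b : branch) (F : T -> \bar R) x :
  (forall y, 0 <= F y) -> 0 <= (weight b x)%:E * F (target b x).
Proof. by move=> F0; rewrite mule_ge0// lee_fin weight_ge0. Qed.

Lemma mixture_ge0 bs (F : T -> \bar R) x : (forall y, 0 <= F y) ->
  0 <= mixture bs F x.
Proof. by move=> F0; apply: sume_ge0 => b _; exact: mixture_term_ge0. Qed.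

Lemma measurable_mixture_term (b : branch) (F : T -> \bar R) :
  measurable_fun [set: T] F ->
  measurable_fun [set: O] (fun x => (weight b x)%:E * F (target b x)).
Proof.
move=> mF; apply: emeasurable_funM.
  by apply/measurable_EFinP; exact: measurable_weight.
by apply: (measurableT_comp mF); exact: measurable_target.
Qed.

Lemma measurable_mixture bs (F : T -> \bar R) :
  measurable_fun [set: T] F -> measurable_fun [set: O] (mixture bs F).
Proof. by move=> mF; apply: emeasurable_sum => b; exact: measurable_mixture_term. Qed.

Lemma le_mixture bs (F G : T -> \bar R) x : (forall y, F y <= G y) ->
  mixture bs F x <= mixture bs G x.
Proof.
move=> FG; apply: lee_sum => b _; apply: lee_wpmul2l => //.
by rewrite lee_fin weight_ge0.
Qed.

Lemma eq_mixture bs (F G : T -> \bar R) : F =1 G -> mixture bs F =1 mixture bs G.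
Proof. by move=> FG x; apply: eq_bigr => b _; rewrite FG. Qed.

Lemma mixtureZ bs (k : R) (F : T -> \bar R) x : (forall y, 0 <= F y) ->
  mixture bs (fun y => k%:E * F y) x = k%:E * mixture bs F x.
Proof.
move=> F0; rewrite ge0_sume_distrr.
  by apply: eq_bigr => b _; rewrite muleCA.
by move=> b _; exact: mixture_term_ge0.
Qed.

Lemma mixture_sum (I : Type) (s : seq I) bs (F : I -> T -> \bar R) x :
  (forall i y, 0 <= F i y) ->
  mixture bs (fun y => \sum_(i <- s) F i y) x = \sum_(i <- s) mixture bs (F i) x.
Proof.
move=> F0; rewrite exchange_big/=; apply: eq_bigr => b _.
by rewrite ge0_sume_distrr.
Qed.

Lemma cvg_mixture bs (F : (T -> \bar R)^nat) (G : T -> \bar R) x :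
  (forall n y, 0 <= F n y) -> (forall y, F ^~ y @ \oo --> G y) ->
  (fun n => mixture bs (F n) x) @ \oo --> mixture bs G x.
Proof.
move=> F0 FG; have G0 y : 0 <= G y.
  by rewrite -(cvg_lim _ (FG y))//; apply: lime_ge;
    [apply/cvg_ex; exists (G y)|exact: nearW].
elim: bs => [|b bs IH].
  rewrite /mixture big_nil; under eq_fun do rewrite big_nil; exact: cvg_cst.
rewrite /mixture big_cons; under eq_fun do rewrite big_cons.
apply: cvgeD => //.
- apply: ge0_adde_def; rewrite inE.
    exact: mixture_term_ge0.
  exact: mixture_ge0.
- exact: cvgeZl.
Qed.

Import HBNNSimple.

(** Standard extension from indicators: linearity gives simple functions, then monotone convergence
    is applied on both sides. *)
Lemma ge0_integral_mixture (mu : {measure set O -> \bar R})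
    (nu : {measure set T -> \bar R}) bs :
  (forall A, measurable A -> nu A = \int[mu]_x mixture bs (EFin \o \1_A) x) ->
  forall F : T -> \bar R, measurable_fun [set: T] F -> (forall y, 0 <= F y) ->
  \int[nu]_y F y = \int[mu]_x mixture bs F x.
Proof.
move=> nuE F mF F0; pose f_ := nnsfun_approx measurableT mF.
have f_0 n y : 0 <= (f_ n y)%:E by rewrite lee_fin.
have mf_ n : measurable_fun [set: T] (EFin \o f_ n) by exact/measurable_EFinP.
have f_nd y : {homo (fun n => (f_ n y)%:E) : m n / (m <= n)%N >-> m <= n}.
  by move=> m n mn; rewrite lee_fin; exact/lefP/nd_nnsfun_approx.
have f_cvg y : (fun n => (f_ n y)%:E) @ \oo --> F y.
  exact: cvg_nnsfun_approx.
transitivity (limn (fun n => \int[nu]_y (f_ n y)%:E)).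
  rewrite -monotone_convergence//.
  by apply: eq_integral => y _; apply/esym/cvg_lim.
transitivity (limn (fun n => \int[mu]_x mixture bs (EFin \o f_ n) x)); last first.
  rewrite -monotone_convergence//.
  - apply: eq_integral => x _; apply/cvg_lim => //.
    by apply: (@cvg_mixture bs (fun n => EFin \o f_ n)).
  - by move=> n; exact: measurable_mixture.
  - by move=> n x _; apply: mixture_ge0; exact: f_0.
  - by move=> x _ m n mn; apply: le_mixture => y; exact: f_nd.
congr (limn _); apply/funext => n.
have mi r : measurable_fun [set: T] (EFin \o \1_(f_ n @^-1` [set r]) : T -> \bar R).
  exact/measurable_EFinP.
(* The simple function is split over its finitely many values; the hypothesis then applies to each
   level set. *)
transitivity (\sum_(r \in range (f_ n)) r%:E * nu (f_ n @^-1` [set r])).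
  under eq_integral do rewrite fimfunE -fsumEFin//.
  rewrite ge0_integral_fsum//.
  - by apply: eq_fsbigr => r _; rewrite integralZl_indic_nnsfun// integral_indic// setIT.
  - by move=> r; apply/measurable_EFinP; exact: measurable_funM.
  - by move=> r x _; rewrite nnfun_muleindic_ge0.
transitivity (\sum_(r \in range (f_ n))
   \int[mu]_x mixture bs (fun y => (r * \1_(f_ n @^-1` [set r]) y)%:E) x).
  apply: eq_fsbigr => r; rewrite inE => -[y _ ry].
  have r0 : (0 <= r)%R by rewrite -ry.
  rewrite nuE// -ge0_integralZl//.
  - apply: eq_integral => x _; rewrite -mixtureZ; last by move=> z; rewrite lee_fin.
    by apply: eq_mixture => z; rewrite EFinM.
  - exact: measurable_mixture.
  - by move=> x _; apply: mixture_ge0 => z; rewrite lee_fin.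
rewrite -ge0_integral_fsum//.
- apply: eq_integral => x _; rewrite fsbig_finite//= -mixture_sum; last first.
    by move=> r y; rewrite nnfun_muleindic_ge0.
  apply: eq_mixture => y /=.
  by rewrite [in RHS]fimfunE -fsumEFin// [in RHS]fsbig_finite.
- move=> r; apply: measurable_mixture.
  by apply/measurable_EFinP; exact: measurable_funM.
- by move=> r x _; apply: mixture_ge0 => y; rewrite nnfun_muleindic_ge0.
Qed.

(** The right-hand side is itself a measure in [A], by monotone convergence, so agreement on a
    generating pi-system suffices. *)
Lemma measure_mixture_ext (mu : {measure set O -> \bar R})
    (nu : {measure set T -> \bar R}) bs (G : set_system T) :
  nu [set: T] < +oo ->
  measurable = <<s G >> -> setI_closed G -> G [set: T] ->
  (forall A, G A -> nu A = \int[mu]_x mixture bs (EFin \o \1_A) x) ->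
  forall A, measurable A -> nu A = \int[mu]_x mixture bs (EFin \o \1_A) x.
Proof.
move=> nuoo mG GI GT nuE.
pose m A := \int[mu]_x mixture bs (EFin \o \1_A) x.
have m0 : m set0 = 0.
  apply: integral0_eq => x _; rewrite /mixture big1// => b _ /=.
  by rewrite indic0 mule0.
have m_ge0 A : 0 <= m A.
  by apply: integral_ge0 => x _; apply: mixture_ge0 => y; rewrite /= lee_fin.
have i0 A y : 0 <= ((\1_A y : R)%:E) by rewrite lee_fin.
have m_sigma : semi_sigma_additive m.
  move=> A mA tA mUA.
  pose g n x := \sum_(0 <= i < n) mixture bs (EFin \o \1_(A i)) x.
  rewrite (_ : (fun n => _) = (fun n => \int[mu]_x g n x)); last first.
    apply/funext => n; rewrite ge0_integral_sum//.
      by move=> k; apply: measurable_mixture; exact/measurable_EFinP.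
    by move=> k x _; apply: mixture_ge0; exact: i0.
  rewrite [X in _ --> X](_ : _ = \int[mu]_x limn (g ^~ x)); last first.
    apply: eq_integral => x _; apply/esym/cvg_lim => //.
    rewrite /g; under eq_fun do [rewrite -mixture_sum; last by move=> i y; exact: i0].
    apply: cvg_mixture => [n y|y]; first by apply: sume_ge0 => i _; exact: i0.
    by rewrite /= indic_bigcup//; apply: is_cvg_nneseries => i _ _; exact: i0.
  apply: (@cvg_monotone_convergence _ _ _ mu _ measurableT g) => //.
  - move=> n; apply: emeasurable_sum => k.
    by apply: measurable_mixture; exact/measurable_EFinP.
  - by move=> n x _; apply: sume_ge0 => k _; apply: mixture_ge0; exact: i0.
  - move=> x _ k l kl; apply: lee_sum_nneg_natr => // i _ _.
    apply: mixture_ge0; exact: i0.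
pose M : {measure set T -> \bar R} :=
  HB.pack m (isMeasure.Build _ _ _ m m0 m_ge0 m_sigma).
apply: (@measure_unique _ _ _ G (fun=> setT) mG GI _ _ nu M) => //.
- by rewrite bigcup_const//; exists 0%N.
Qed.

End mixture.
Arguments mixture {d O d' T R} bs F x.

(** * Exponential waiting times *)

Section decay.
Context (R : realType).
Local Notation mu := (@lebesgue_measure R).

Lemma lebesgue_measure_shift (a : R) (A : set R) : measurable A ->
  pushforward mu (fun x => x + a : measurableTypeR R) A = mu A.
Proof.
move=> mA; have mD : measurable_fun [set: R] (fun x => x + a : measurableTypeR R).
  by apply: measurable_funD.
apply/esym/lebesgue_measure_unique => //= _ [[b c]] _ <-.
rewrite /pushforward.
rewrite (_ : _ @^-1` _ = [set` `]b - a, c - a]]); last first.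
  by apply/seteqP; split => x /=; rewrite !in_itv/= ltrBlDr lerBrDr.
by rewrite !lebesgue_measure_itv/= !lte_fin ltrD2r; case: ifP => // _;
  rewrite -!EFinD; congr EFin; ring.
Qed.

Lemma ge0_integral_shift (a : R) (f : R -> \bar R) :
  measurable_fun [set: R] f -> (forall x, (0 <= f x)%E) ->
  (\int[mu]_x f (x + a)%R = \int[mu]_x f x)%E.
Proof.
move=> mf f0; have mD : measurable_fun [set: R] (fun x => x + a : measurableTypeR R).
  by apply: measurable_funD.
transitivity (\int[pushforward mu (fun x : R => (x + a)%R : measurableTypeR R)]_x f x)%E.
  by rewrite ge0_integral_pushforward.
by apply: eq_measure_integral => A mA _; exact: lebesgue_measure_shift.
Qed.

(** Survival function of an exponential time of rate [a], cut off at negative [s]. The cut-off lets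
    all integrals run over the whole line, where translation and Tonelli apply directly. *)
Definition decay (a s : R) : R := (0 <= s)%R%:R * expR (- (a * s)).

Lemma decay_ge0 a s : 0 <= decay a s.
Proof. by rewrite mulr_ge0// expR_ge0. Qed.

Lemma decayE a s : 0 <= s -> decay a s = expR (- (a * s)).
Proof. by rewrite /decay => ->; rewrite mul1r. Qed.

Lemma decay0 a s : s < 0 -> decay a s = 0.
Proof. by rewrite /decay ltNge => /negbTE ->; rewrite mul0r. Qed.

Lemma measurable_decay d (T : measurableType d) (a s : T -> R) :
  measurable_fun [set: T] a -> measurable_fun [set: T] s ->
  measurable_fun [set: T] (fun x => decay (a x) (s x)).
Proof.
move=> ma ms; apply: measurable_funM; last first.
  apply: measurableT_comp => //; apply: measurableT_comp => //.
  exact: measurable_funM.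
rewrite (_ : (fun _ => _) = (\1_`[0, +oo[%classic : R -> R) \o s).
  by apply: measurableT_comp.
by apply/funext => x /=; rewrite indicE /= mem_setE in_itv/= andbT.
Qed.

Lemma exponential_pdf_decay a s : exponential_pdf a s = a * decay a s.
Proof.
have [s0|s0] := leP 0 s.
  by rewrite exponential_pdfE// decayE// mulNr.
by rewrite lt0_exponential_pdf// decay0// mulr0.
Qed.

Lemma integral_decay a : 0 < a ->
  (a%:E * \int[mu]_s (decay a s)%:E = 1)%E.
Proof.
move=> a0; rewrite -ge0_integralZl//.
- under eq_integral do rewrite -EFinM -exponential_pdf_decay.
  exact: integral_exponential_pdf.
- by apply/measurable_EFinP; exact: measurable_decay.
- by move=> s _; rewrite lee_fin decay_ge0.
- by rewrite lee_fin ltW.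
Qed.

Lemma integral_decay_itv (c v : R) : 0 <= v ->
  (\int[mu]_(s in `[0%R, v]) (c * decay c s)%:E = (1 - expR (- (c * v)))%:E)%E.
Proof.
rewrite le_eqVlt => /predU1P[<-|v0].
  by rewrite set_itv1 integral_set1 mulr0 oppr0 expR0 subrr.
under eq_integral do rewrite -exponential_pdf_decay.
by rewrite -[LHS]/(exponential_prob c `[0%R, v]%classic) exponential_prob_itv0c// mulNr.
Qed.

(** The integrand vanishes unless [0 <= s <= v], and there it factors as [expR (- (a * v))] times
    the exponential density of rate [B - a]. *)
Lemma integral_decay_conv (a B v : R) : a <= B ->
  (\int[mu]_s ((B - a) * decay B s * decay a (v - s))%:E
   = (decay a v - decay B v)%:E)%E.
Proof.
move=> aB; have [v0|v0] := leP 0 v; last first.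
  rewrite !decay0// subrr; apply: integral0_eq => s _.
  have [s0|s0] := leP 0 s; last by rewrite (decay0 _ s0) mulr0 mul0r.
  by rewrite [decay a _]decay0 ?mulr0// subr_lt0 (lt_le_trans v0).
rewrite !decayE//.
transitivity (\int[mu]_(s in `[0%R, v])
    ((expR (- (a * v)))%:E * ((B - a) * decay (B - a) s)%:E))%E.
  rewrite [RHS]integral_mkcond; apply: eq_integral => s _; rewrite patchE.
  case: ifPn => [|/negP]; rewrite inE/= in_itv/=.
    move=> /andP[s0 sv]; rewrite -EFinM; congr EFin.
    rewrite !decayE ?subr_ge0// mulrCA -mulrA -!expRD; congr (_ * expR _).
    by ring.
  move=> /negP; rewrite negb_and -!ltNge => /orP[s0|vs].
    by rewrite (decay0 _ s0) mulr0 mul0r.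
  by rewrite [decay a _]decay0 ?mulr0// subr_lt0.
rewrite ge0_integralZl//.
- rewrite integral_decay_itv// -EFinM; congr EFin.
  by rewrite mulrBr mulr1 -expRD; congr (_ - expR _); ring.
- apply: measurable_funTS; apply/measurable_EFinP; apply: measurable_funM => //.
  exact: measurable_decay.
- by move=> s _; rewrite lee_fin mulr_ge0 ?subr_ge0// decay_ge0.
Qed.

(** With [v = s + u] and the integrals swapped, the double integral becomes that of [q v] against
    the convolution [decay a v - decay B v]; its negative part cancels the first term. *)
Lemma integral_decay_uniformization (a B : R) (q : R -> \bar R) : a <= B ->
  measurable_fun [set: R] q -> (forall s, (0 <= q s)%E) ->
  (\int[mu]_s ((decay B s)%:E *
      (q s + (B - a)%:E * \int[mu]_u ((decay a u)%:E * q (s + u)%R)))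
   = \int[mu]_s ((decay a s)%:E * q s))%E.
Proof.
move=> aB mq q0.
have Ba0 : 0 <= B - a by rewrite subr_ge0.
pose k (s v : R) := (B - a) * decay B s * decay a (v - s).
have k0 s v : 0 <= k s v by rewrite !mulr_ge0 ?decay_ge0.
have mk d (T : measurableType d) (f g : T -> R) : measurable_fun [set: T] f ->
    measurable_fun [set: T] g -> measurable_fun [set: T] (fun x => k (f x) (g x)).
  move=> mf mg; apply: measurable_funM; last first.
    by apply: measurable_decay => //; apply: measurable_funB.
  by apply: measurable_funM => //; exact: measurable_decay.
have mdq c : measurable_fun [set: R] (fun s => ((decay c s)%:E * q s)%E).
  by apply: emeasurable_funM => //; apply/measurable_EFinP; exact: measurable_decay.
have mkq d (T : measurableType d) (f g : T -> R) : measurable_fun [set: T] f ->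
    measurable_fun [set: T] g ->
    measurable_fun [set: T] (fun x => ((k (f x) (g x))%:E * q (g x))%E).
  move=> mf mg; apply: emeasurable_funM; first exact/measurable_EFinP/mk.
  exact: (measurableT_comp mq).
have kq0 s v : (0 <= (k s v)%:E * q v)%E by rewrite mule_ge0 ?lee_fin.
have shift s : ((decay B s)%:E *
    ((B - a)%:E * \int[mu]_u ((decay a u)%:E * q (s + u)%R)) =
    \int[mu]_v ((k s v)%:E * q v))%E.
  rewrite -[RHS](@ge0_integral_shift s)//; last exact: mkq.
  rewrite muleA -EFinM -ge0_integralZl//=.
  - apply: eq_integral => u _; rewrite muleA -EFinM [s + u]addrC; congr (_%:E * _)%E.
    by rewrite /k addrK; ring.
  - apply: emeasurable_funM; first by apply/measurable_EFinP; exact: measurable_decay.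
    by apply: (measurableT_comp mq); exact: measurable_funD.
  - by move=> u _; rewrite mule_ge0// lee_fin decay_ge0.
  - by rewrite lee_fin mulr_ge0// decay_ge0.
under eq_integral => s _.
  rewrite ge0_muleDr//; last first.
    rewrite mule_ge0//; apply: integral_ge0 => u _.
    by rewrite mule_ge0// lee_fin decay_ge0.
  rewrite shift.
  over.
rewrite ge0_integralD//=; first last.
- apply: (@measurable_fun_fubini_tonelli_F _ _ _ _ R mu
    (fun sv => ((k sv.1 sv.2)%:E * q sv.2)%E)) => //.
  exact: mkq.
- by move=> s _; apply: integral_ge0.
- exact: mdq.
- by move=> s _; rewrite mule_ge0// lee_fin decay_ge0.
rewrite (@fubini_tonelli _ _ _ _ R mu mu
  (fun sv => ((k sv.1 sv.2)%:E * q sv.2)%E))//=; last first.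
  exact: mkq.
rewrite -ge0_integralD//=.
- apply: eq_integral => v _.
  rewrite ge0_integralZr//; first last.
  + by move=> s _; rewrite lee_fin.
  + by apply/measurable_EFinP; exact: mk.
  rewrite integral_decay_conv// -ge0_muleDl ?lee_fin ?decay_ge0//.
    by rewrite -EFinD addrC subrK.
  (* The difference is nonnegative because it is the integral of the nonnegative [k]. *)
  have -> : decay a v - decay B v = fine (\int[mu]_s (k s v)%:E).
    by rewrite integral_decay_conv.
  by apply: fine_ge0; apply: integral_ge0 => s _; rewrite lee_fin.
- by move=> v _; rewrite mule_ge0// lee_fin decay_ge0.
- exact: mdq.
- by move=> v _; apply: integral_ge0.
- apply: (@measurable_fun_fubini_tonelli_G _ _ _ _ R mu
    (fun sv => ((k sv.1 sv.2)%:E * q sv.2)%E)) => //.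
  exact: mkq.
Qed.

End decay.

(** * Conditioning on the past *)

Section kernel_integral.
Context (R : realType) dS (S : measurableType dS) dU (U : measurableType dU).
Local Open Scope ereal_scope.
Local Notation leb := (@lebesgue_measure R).
Variable bs : seq (@branch _ (S * R)%type _ U R).

(** A kernel from [S] to [U] that mixes over a waiting time [s]; the density of [s] is contained in
    the weights of the branches. *)
Definition kint (f : U -> \bar R) (x : S) : \bar R :=
  \int[leb]_s mixture bs f (x, s).

Lemma kint_ge0 (f : U -> \bar R) x : (forall u, 0 <= f u) -> 0 <= kint f x.
Proof. by move=> f0; apply: integral_ge0 => s _; exact: mixture_ge0. Qed.

Lemma measurable_mixture_slice (f : U -> \bar R) x : measurable_fun [set: U] f ->
  measurable_fun [set: R] (fun s => mixture bs f (x, s)).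
Proof.
by move=> mf; apply: measurableT_comp; [exact: measurable_mixture|exact: measurable_pair1].
Qed.

Lemma le_kint (f g : U -> \bar R) x : measurable_fun [set: U] f ->
  measurable_fun [set: U] g -> (forall u, 0 <= f u) -> (forall u, f u <= g u) ->
  kint f x <= kint g x.
Proof.
move=> mf mg f0 fg; apply: ge0_le_integral => //.
- by move=> s _; exact: mixture_ge0.
- exact: measurable_mixture_slice.
- exact: measurable_mixture_slice.
- by move=> s _; exact: le_mixture.
Qed.

Lemma kintZ (k : R) (f : U -> \bar R) x : measurable_fun [set: U] f ->
  (forall u, 0 <= f u) -> (0 <= k)%R ->
  kint (fun u => k%:E * f u) x = k%:E * kint f x.
Proof.
move=> mf f0 k0; rewrite /kint -ge0_integralZl//.
- by apply: eq_integral => s _; rewrite mixtureZ.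
- exact: measurable_mixture_slice.
- by move=> s _; exact: mixture_ge0.
Qed.

Lemma eq_kint (f g : U -> \bar R) : f =1 g -> kint f =1 kint g.
Proof. by move=> fg x; apply: eq_integral => s _; exact: eq_mixture. Qed.

(** * Keeping the past alongside the next epoch *)

Section lift.
Context dW (W : measurableType dW) dA (A : measurableType dA).
Variables (Y : W -> A) (Z : W -> S).
Hypotheses (mY : measurable_fun [set: W] Y) (mZ : measurable_fun [set: W] Z).

(** Lebesgue measure lives on [measurableTypeR R], whose measurable structure agrees with that of
    [R] by conversion; hence the restatement closed by [exact]. *)
Let mZs : @measurable_fun _ _ (W * measurableTypeR R)%type (S * R)%type
  setT (fun ws => (Z ws.1, ws.2)).
Proof.
have : measurable_fun [set: W * R] (fun ws => (Z ws.1, ws.2)).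
  by apply: measurable_fun_pair => //; apply: measurableT_comp.
exact.
Qed.

(** The target also carries the past [Y], so that functions of past and future can be integrated
    jointly. *)
Definition lift_branch (b : @branch _ (S * R)%type _ U R) :
    @branch _ (W * measurableTypeR R)%type _ (A * U)%type R :=
  @Branch _ (W * measurableTypeR R)%type _ (A * U)%type R
    (fun ws => weight b (Z ws.1, ws.2))
    (fun ws => (Y ws.1, target b (Z ws.1, ws.2)))
    (fun ws => weight_ge0 b _)
    (measurableT_comp (measurable_weight b) mZs)
    (measurable_fun_pair (measurableT_comp mY measurable_fst)
       (measurableT_comp (measurable_target b) mZs)).

Lemma mixture_lift (F : A * U -> \bar R) w s :
  mixture (map lift_branch bs) F (w, s) =
  mixture bs (fun u => F (Y w, u)) (Z w, s).
Proof. by rewrite /mixture big_map. Qed.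

End lift.

(** Lifting with the identity as past turns this into the measurability of a partial integral in
    Tonelli's theorem. *)
Lemma measurable_kint dW (W : measurableType dW) (Z : W -> S)
    (F : W * U -> \bar R) : measurable_fun [set: W] Z ->
  measurable_fun [set: W * U] F -> (forall x, 0 <= F x) ->
  measurable_fun [set: W] (fun w => kint (fun u => F (w, u)) (Z w)).
Proof.
move=> mZ mF F0.
pose cs := map (lift_branch (@measurable_id _ W setT) mZ) bs.
have mm : measurable_fun [set: W * measurableTypeR R] (mixture cs F).
  exact: measurable_mixture.
have m0 ws : 0 <= mixture cs F ws by exact: mixture_ge0.
have := @measurable_fun_fubini_tonelli_F _ _ W (measurableTypeR R) R leb _ mm m0.
apply: eq_measurable_fun => w _; apply: eq_integral => s _.
by rewrite mixture_lift.
Qed.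

(* The hypothesis says that [kint ^~ (Z w)] is the conditional law of [V] given
   [Y]: then [Y] can be treated as a constant when integrating over [V]. *)
Lemma freezing dW (W : measurableType dW) (P : probability W R)
    dA (A : measurableType dA) (Y : W -> A) (Z : W -> S) (V : W -> U)
    (mY : measurable_fun [set: W] Y) (mZ : measurable_fun [set: W] Z)
    (mV : measurable_fun [set: W] V) :
  (forall D C, measurable D -> measurable C ->
    P (Y @^-1` D `&` V @^-1` C) =
    \int[P]_(w in Y @^-1` D) kint (EFin \o \1_C) (Z w)) ->
  forall F : A * U -> \bar R,
    measurable_fun [set: A * U] F -> (forall x, 0 <= F x) ->
  \int[P]_w F (Y w, V w) = \int[P]_w kint (fun u => F (Y w, u)) (Z w).
Proof.
move=> PE F mF F0.
have mYV : measurable_fun [set: W] (fun w => (Y w, V w)) by exact: measurable_fun_pair.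
pose cs := map (lift_branch mY mZ) bs.
have fubini (G : A * U -> \bar R) : measurable_fun [set: A * U] G ->
    (forall x, 0 <= G x) ->
    \int[P \x leb]_ws mixture cs G ws =
    \int[P]_w kint (fun u => G (Y w, u)) (Z w).
  move=> mG G0.
  have mm : measurable_fun [set: W * measurableTypeR R] (mixture cs G).
    exact: measurable_mixture.
  rewrite fubini_tonelli1//; last by move=> ws; exact: mixture_ge0.
  by apply: eq_integral => w _; apply: eq_integral => s _; rewrite mixture_lift.
rewrite -fubini// -(@ge0_integral_mixture _ _ _ _ _ (P \x leb)
  (pushforward P (fun w => (Y w, V w))) cs)//.
  by rewrite ge0_integral_pushforward.
(* It remains to identify the joint law of [(Y, V)]. Rectangles form a pi-system, and on them the
   claim is the hypothesis. *)
apply: (@measure_mixture_ext _ _ _ _ _ _ _ _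
  [set D `*` C | D in measurable & C in measurable]).
- by rewrite /= /pushforward preimage_setT (le_lt_trans (probability_le1 _ _)) ?ltry.
- exact: measurable_prod_measurableType.
- move=> _ _ [D mD [C mC <-]] [D' mD' [C' mC' <-]].
  exists (D `&` D'); first exact: measurableI.
  by exists (C `&` C'); [exact: measurableI|rewrite setXI].
- by exists setT => //; exists setT => //; rewrite setXTT.
- move=> _ [D mD [C mC <-]].
  rewrite fubini; last 2 first.
  + by apply/measurable_EFinP; apply: measurable_indic; exact: measurableX.
  + by move=> x; rewrite /= lee_fin.
  rewrite /pushforward [LHS](PE _ _ mD mC) integral_mkcond; apply: eq_integral => w _.
  rewrite patchE; case: ifPn => [|/negP]; rewrite inE/= => Dw.
    apply: eq_kint => u /=; congr (_%:E).
    by rewrite !indicE; congr (nat_of_bool _)%:R; apply/idP/idP; rewrite !inE/= => // -[].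
  apply/esym/integral0_eq => s _; rewrite /mixture big1// => b _ /=.
  by rewrite indicE memNset ?mule0// => -[].
Qed.

End kernel_integral.

(** * Observations at fixed times *)

Section observation.
Context (R : realType) (n : nat) (tau : n.-tuple R).
Local Notation S := (state R).
Local Notation Y := (R * S * n.-tuple S)%type.

(* [(r, x, v)]: the last epoch took place at time [r] and led to [x]; [v k] is the
   state at time [tau k] if [tau k < r], and irrelevant otherwise. *)
Definition observe (y : Y) (s : R) : n.-tuple S :=
  [tuple if y.1.1 <= tnth tau k < y.1.1 + s
         then flow y.1.2 (tnth tau k - y.1.1) else tnth y.2 k | k < n].

Definition advance (y : Y) (u : R * S) : Y := (y.1.1 + u.1, u.2, observe y u.1).

Lemma measurable_flow : measurable_fun [set: S * R] (fun z => flow z.1 z.2).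
Proof.
apply: measurable_fun_pair.
  by apply: measurableT_comp => //; exact: measurableT_comp.
by apply: measurable_funD => //; exact: measurableT_comp.
Qed.

Lemma measurable_observe :
  measurable_fun [set: Y * R] (fun z => observe z.1 z.2).
Proof.
apply/measurable_fun_tnthP => k.
rewrite (_ : _ \o _ = fun z : Y * R => if z.1.1.1 <= tnth tau k < z.1.1.1 + z.2
  then flow z.1.1.2 (tnth tau k - z.1.1.1) else tnth z.1.2 k); last first.
  by apply/funext => z /=; rewrite tnth_mktuple.
have m1 : measurable_fun [set: Y * R] (fun z => z.1.1.1).
  by do 2 apply: measurableT_comp => //.
apply: measurable_fun_ifT.
- apply: measurable_and.
    by apply: measurable_fun_ler.
  by apply: measurable_fun_ltr => //; apply: measurable_funD.
- apply: (@measurableT_comp _ _ _ _ _ _ (fun z => flow z.1 z.2) _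
      (fun z : Y * R => (z.1.1.2, tnth tau k - z.1.1.1))).
    exact: measurable_flow.
  apply: measurable_fun_pair; last exact: measurable_funB.
  by do 2 apply: measurableT_comp => //.
- apply: (@measurableT_comp _ _ _ _ _ _ (fun v : n.-tuple S => tnth v k)).
    exact: measurable_tnth.
  exact: measurableT_comp.
Qed.

Lemma measurable_advance :
  measurable_fun [set: Y * (R * S)] (fun z => advance z.1 z.2).
Proof.
apply: measurable_fun_pair; first apply: measurable_fun_pair.
- apply: measurable_funD; first by do 2 apply: measurableT_comp => //.
  exact: measurableT_comp.
- exact: measurableT_comp.
- apply: (@measurableT_comp _ _ _ _ _ _ (fun z : Y * R => observe z.1 z.2) _
      (fun z : Y * (R * S) => (z.1, z.2.1))).
    exact: measurable_observe.
  apply: measurable_fun_pair => //; exact: measurableT_comp.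
Qed.

(** Cutting a stretch of pure drift at time [s] does not alter what is observed, so a dummy epoch
    leaves no trace in the record. *)
Lemma observeD y (s u : R) : 0 <= s -> 0 <= u ->
  observe (y.1.1 + s, flow y.1.2 s, observe y s) u = observe y (s + u).
Proof.
move=> s0 u0; apply: eq_from_tnth => k; rewrite !tnth_mktuple /=.
have [ltk|lek] := ltP (tnth tau k) (y.1.1 + s).
  rewrite andFb andbT addrA (lt_le_trans ltk) ?andbT// lerDl//.
rewrite andTb andbF (le_trans _ lek) ?lerDl//= addrA.
by case: ifP => // _; rewrite /flow /=; congr (_, _); ring.
Qed.

Variable bs : seq (@branch _ (S * R)%type _ (R * S)%type R).

Definition step (F : Y -> \bar R) (y : Y) : \bar R :=
  kint bs (fun u => F (advance y u)) y.1.2.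

Lemma step_ge0 F : (forall y, (0 <= F y)%E) -> forall y, (0 <= step F y)%E.
Proof. by move=> F0 y; exact: kint_ge0. Qed.

Lemma measurable_step F : (forall y, (0 <= F y)%E) ->
  measurable_fun [set: Y] F -> measurable_fun [set: Y] (step F).
Proof.
move=> F0 mF.
apply: (@measurable_kint _ _ _ _ _ _ _ _ (fun y : Y => y.1.2)
  (fun z : Y * (R * S) => F (advance z.1 z.2))) => //.
  exact: measurableT_comp.
exact: (measurableT_comp mF measurable_advance).
Qed.

Lemma iter_step_ge0 F m : (forall y, (0 <= F y)%E) ->
  forall y, (0 <= iter m step F y)%E.
Proof. by move=> F0; elim: m => //= m IH; exact: step_ge0. Qed.

Lemma measurable_iter_step F m : (forall y, (0 <= F y)%E) ->
  measurable_fun [set: Y] F -> measurable_fun [set: Y] (iter m step F).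
Proof.
move=> F0 mF; elim: m => //= m IH; apply: measurable_step => //.
exact: iter_step_ge0.
Qed.

(** Once every [tau k] lies strictly before the last epoch, the record is complete and further calls
    of [advance] leave it unchanged. *)
Definition all_observed (A : set (n.-tuple S)) : set Y :=
  [set y | (forall k, tnth tau k < y.1.1) /\ A y.2].

Lemma measurable_all_observed A : measurable A -> measurable (all_observed A).
Proof.
move=> mA.
have -> : all_observed A = (\bigcap_(k in [set: 'I_n])
    ((fun y : Y => tnth tau k < y.1.1) @^-1` [set true])) `&` snd @^-1` A.
  by apply/seteqP; split => y [yk Ay]; split => //= k; [move=> _; exact: yk|exact: (yk k I)].
apply: measurableI; last by rewrite -[X in measurable X]setTI; exact: measurable_snd.
apply: fin_bigcap_measurable => // k _.
rewrite -[X in measurable X]setTI.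
apply: (@measurable_fun_ltr _ _ _ setT (fun=> tnth tau k) (fun y : Y => y.1.1)) => //.
exact: measurableT_comp.
Qed.

(** The tuple is a placeholder: with nonnegative observation times, none lies before the initial
    epoch 0. *)
Definition start (x : S) : Y := (0, x, [tuple x | k < n]).

(** [Q m] folds [advance] over the first [m] epochs of the process. Its law follows by conditioning
    on the past one epoch at a time. *)
Lemma process_observation (K : epoch_kernel R) (x : S) d (W : measurableType d)
    (P : probability W R) (X : R -> W -> S) :
  (forall k, 0 <= tnth tau k) ->
  (forall y, in_S y -> forall C, measurable C -> K y C = kint bs (EFin \o \1_C) y) ->
  is_process K x P X ->
  exists Q : nat -> W -> Y,
    [/\ forall m, measurable_fun [set: W] (Q m),
        forall F, measurable_fun [set: Y] F -> (forall y, (0 <= F y)%E) ->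
          forall m, (\int[P]_w F (Q m w) = iter m step F (start x))%E &
        forall m w k, tnth tau k < (Q m w).1.1 ->
          tnth (Q m w).2 k = X (tnth tau k) w].
Proof.
move=> tau0 KE [T [Z [mT mZ Z0 TZ XE]]].
pose U m w := (T m w, Z m.+1 w).
pose Q := fix Q m w := if m is m'.+1 then advance (Q m' w) (U m' w)
  else start x.
have mU m : measurable_fun [set: W] (U m).
  by apply: measurable_fun_pair; [case: (mT m)|case: (mZ m.+1)].
have mQ m : measurable_fun [set: W] (Q m).
  elim: m => [|m IH]; first exact: measurable_cst.
  exact: (measurableT_comp measurable_advance (measurable_fun_pair IH (mU m))).
have QZ m w : (Q m w).1.2 = Z m w by case: m => //=; rewrite Z0.
have QT m w : (Q m w).1.1 = \sum_(k < m) T k w.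
  by elim: m => [|m IH] /=; [rewrite big_ord0|rewrite IH big_ord_recr].
(* [Q j] depends only on the first [j] pairs of waiting time and next state, so its events belong to
   the past that [is_process] conditions on. *)
have Qpast m j : (j <= m)%N -> forall D, measurable D ->
    g_sigma_preimage (fun k : 'I_m => U k) (Q j @^-1` D).
  move=> jm D mD.
  pose G := \big[setU/set0]_(k < m) preimage_set_system setT (U k) measurable.
  suff : @measurable_fun _ _ (g_sigma_algebraType G) _ setT (Q j).
    by move=> /(_ measurableT D mD); rewrite setTI.
  elim: j jm {D mD} => [_|j IH jm]; first exact: measurable_cst.
  apply: (@measurableT_comp _ _ _ _ _ _ (fun z => advance z.1 z.2) _
    (fun w : g_sigma_algebraType G => (Q j w, U j w))).
    exact: measurable_advance.
  apply: measurable_fun_pair; first exact: IH (ltnW jm).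
  move=> _ D mD; apply: sub_sigma_algebra.
  apply: (@bigsetU_sup _ _ _ (fun k => preimage_set_system setT (U k) measurable) jm).
  by exists D.
exists Q; split => //.
  move=> F mF F0 m; elim: m F mF F0 => [|m IH] F mF F0.
    transitivity (F (start x) * P setT)%E.
      exact: (@integral_cst _ _ _ P _ measurableT (F (start x))).
    by rewrite probability_setT mule1.
  (* The last epoch is integrated out first, which replaces [F] by [step F]; this is why the
     induction is over all [F]. *)
  rewrite iterSr -IH; last 2 first.
  - exact: measurable_step.
  - exact: step_ge0.
  rewrite -[LHS]/(\int[P]_w ((fun z => F (advance z.1 z.2)) (Q m w, U m w)))%E.
  rewrite (@freezing _ _ _ _ _ bs _ _ P _ _ (Q m) (fun w => (Q m w).1.2))//.
  - by apply: measurableT_comp => //; exact: measurableT_comp.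
  - move=> D C mD mC; rewrite (TZ _ _ _ (Qpast m m (leqnn m) D mD) mC).
    by apply: eq_integral => w _; rewrite QZ KE//; case: (mZ m).
  - exact: (measurableT_comp mF measurable_advance).
elim=> [|m IH] w k /=; first by rewrite ltNge tau0.
rewrite tnth_mktuple => kT; have [_ _ Xflow] := XE _ (tau0 k).
(* Either [tau k] falls between epochs [m] and [m.+1], where [X] follows the drift, or it was
   observed earlier. *)
case: ifPn => [/andP[Tk kT'] |].
  rewrite (Xflow m w); first by rewrite QZ QT.
  by rewrite -!QT Tk.
rewrite negb_and -ltNge kT orbF => Tk.
by rewrite IH.
Qed.


End observation.

(** * Uniformization *)

Section uniformization.
Context (R : realType).
Local Notation S := (state R).

Lemma measurable_flow_slice (x : S) : measurable_fun [set: R] (flow x).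
Proof. exact: measurableT_comp (@measurable_flow R) (measurable_pair1 x). Qed.

Lemma measurable_mixture_flow (bs : seq (@branch _ S _ S R)) (f : R * S -> \bar R) x :
  measurable_fun [set: R * S] f ->
  measurable_fun [set: R] (fun s => mixture bs (fun y => f (s, y)) (flow x s)).
Proof.
move=> mf; have mflow := measurable_flow_slice x.
apply: emeasurable_sum => b; apply: emeasurable_funM.
  by apply/measurable_EFinP; exact: (measurableT_comp (measurable_weight b) mflow).
apply: (measurableT_comp mf); apply: measurable_fun_pair => //.
exact: (measurableT_comp (measurable_target b) mflow).
Qed.

Variables (rs : seq (@branch _ S _ S R)) (L : S -> R) (B : R).
Hypotheses (mL : measurable_fun [set: S] L) (L_gt0 : forall x, 0 < L x)
  (L_le : forall x, L x <= B) (L_flow : forall x s, L (flow x s) = L x)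
  (L_sum : forall x, L x = \sum_(b <- rs) weight b x).

Let B_gt0 : 0 < B. Proof. exact: lt_le_trans (L_gt0 point) (L_le point). Qed.

(** * Branches delayed by an exponential waiting time *)

Section timed.
Variable c : S -> R.
Hypothesis mc : measurable_fun [set: S] c.

Let mflow : measurable_fun [set: S * R] (fun z => flow z.1 z.2).
Proof. exact: measurable_flow. Qed.

Lemma timed_weight_ge0 (b : @branch _ S _ S R) (z : S * R) :
  0 <= decay (c z.1) z.2 * weight b (flow z.1 z.2).
Proof. by rewrite mulr_ge0 ?decay_ge0 ?weight_ge0. Qed.

Lemma measurable_timed_weight (b : @branch _ S _ S R) :
  measurable_fun [set: S * R]
    (fun z => decay (c z.1) z.2 * weight b (flow z.1 z.2)).
Proof.
apply: measurable_funM.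
  by apply: measurable_decay => //; apply: measurableT_comp.
exact: (measurableT_comp (measurable_weight b) mflow).
Qed.

Lemma measurable_timed_target (b : @branch _ S _ S R) :
  measurable_fun [set: S * R] (fun z => (z.2, target b (flow z.1 z.2))).
Proof.
apply: measurable_fun_pair => //.
exact: (measurableT_comp (measurable_target b) mflow).
Qed.

(** The transition [b] occurs at the state reached by the drift after the wait, and the elapsed time
    is recorded in the target. *)
Definition timed (b : @branch _ S _ S R) : @branch _ (S * R)%type _ (R * S)%type R :=
  Branch (timed_weight_ge0 b) (measurable_timed_weight b) (measurable_timed_target b).

Lemma mixture_timed bs (f : R * S -> \bar R) x s : (forall u, (0 <= f u)%E) ->
  mixture (map timed bs) f (x, s) =
  ((decay (c x) s)%:E * mixture bs (fun y => f (s, y)) (flow x s))%E.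
Proof.
move=> f0; rewrite /mixture big_map ge0_sume_distrr.
  by apply: eq_bigr => b _; rewrite /= EFinM muleA.
by move=> b _; rewrite mule_ge0// lee_fin weight_ge0.
Qed.

End timed.

Lemma dummy_weight_ge0 (x : S) : 0 <= B - L x.
Proof. by rewrite subr_ge0. Qed.

Lemma measurable_dummy_weight : measurable_fun [set: S] (fun x => B - L x).
Proof. exact: measurable_funB. Qed.

(** Tops up the total rate from [L x] to [B] while leaving the state as it is. *)
Definition dummy : @branch _ S _ S R :=
  Branch dummy_weight_ge0 measurable_dummy_weight (@measurable_id _ S setT).

Definition jump_branches := map (timed mL) rs.
Definition unif_branches := map (timed (@measurable_cst _ _ S R setT B)) (dummy :: rs).

(** * Comparison of the two one-epoch operators *)

Section comparison.
Context (n : nat) (tau : n.-tuple R).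
Local Notation Y := (R * S * n.-tuple S)%type.
Local Notation leb := (@lebesgue_measure R).
Local Open Scope ereal_scope.

Let measurable_advance_slice y : measurable_fun [set: R * S] (advance tau y).
Proof. exact: measurableT_comp (@measurable_advance R n tau) (measurable_pair1 y). Qed.

(** Contribution of the transitions in [rs] at time [s], common to both operators. *)
Let q (F : Y -> \bar R) (y : Y) (s : R) : \bar R :=
  mixture rs (fun z => F (advance tau y (s, z))) (flow y.1.2 s).

Let q_ge0 F y s : (forall z, 0 <= F z) -> 0 <= q F y s.
Proof. by move=> F0; exact: mixture_ge0. Qed.

Let measurable_q F y : measurable_fun [set: Y] F -> measurable_fun [set: R] (q F y).
Proof.
move=> mF; apply: (@measurable_mixture_flow rs (fun u => F (advance tau y u))).
exact: (measurableT_comp mF (measurable_advance_slice y)).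
Qed.

Lemma step_jump F y : (forall z, 0 <= F z) ->
  step tau jump_branches F y = \int[leb]_s ((decay (L y.1.2) s)%:E * q F y s).
Proof. by move=> F0; apply: eq_integral => s _; rewrite mixture_timed. Qed.

Lemma step_unif F y : (forall z, 0 <= F z) ->
  step tau unif_branches F y = \int[leb]_s ((decay B s)%:E *
    (q F y s + (B - L y.1.2)%:E * F (advance tau y (s, flow y.1.2 s)))).
Proof.
move=> F0; apply: eq_integral => s _; rewrite mixture_timed//.
by rewrite /mixture big_cons /= L_flow addeC.
Qed.

(** After a dummy epoch at [s] the rate is still [L y.1.2], by constancy along the drift, and by
    [observeD] the next jump is observed as if the dummy epoch had not occurred. *)
Lemma step_jump_advance F y s : (forall z, 0 <= F z) -> (0 <= s)%R ->
  step tau jump_branches F (advance tau y (s, flow y.1.2 s)) =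
  \int[leb]_u ((decay (L y.1.2) u)%:E * q F y (s + u)%R).
Proof.
move=> F0 s0; rewrite step_jump//; apply: eq_integral => u _ /=.
rewrite L_flow; have [u0|u0] := leP 0%R u; last by rewrite decay0// !mul0e.
congr (_ * _); rewrite /q /=.
have -> : flow (flow y.1.2 s) u = flow y.1.2 (s + u).
  by rewrite /flow /= addrA.
apply: eq_mixture => z; congr (F _).
by rewrite /advance /= observeD// addrA.
Qed.

(* A jump of the rate process is a jump of the uniformized one preceded by
   any number of dummy transitions. *)
Lemma step_unif_jump F y : measurable_fun [set: Y] F -> (forall z, 0 <= F z) ->
  \int[leb]_s ((decay B s)%:E * (q F y s + (B - L y.1.2)%:E *
     step tau jump_branches F (advance tau y (s, flow y.1.2 s)))) =
  step tau jump_branches F y.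
Proof.
move=> mF F0; rewrite step_jump//.
rewrite -(@integral_decay_uniformization _ (L y.1.2) B)//; last 2 first.
- exact: measurable_q.
- by move=> s; exact: q_ge0.
apply: eq_integral => s _; have [s0|s0] := leP 0%R s; last by rewrite decay0// !mul0e.
by rewrite step_jump_advance.
Qed.

(* Makes [E exp(-S_m)] geometric in [m], hence rules out explosion. *)
Lemma step_unif_expR y :
  step tau unif_branches (fun z => (expR (- z.1.1))%:E) y =
  (B / (B + 1) * expR (- y.1.1))%:E.
Proof.
have e0 r : (0 <= expR (- r) :> R)%R by exact: expR_ge0.
have B1 : (0 < B + 1)%R by rewrite addr_gt0.
rewrite step_unif; last by move=> z; rewrite lee_fin.
(* The rates sum to [L + (B - L) = B], and the factor [exp(-s)] of the new epoch time raises the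
   decay rate from [B] to [B + 1]. *)
transitivity (\int[leb]_s ((B * expR (- y.1.1))%:E * (decay (B + 1) s)%:E)).
  apply: eq_integral => s _; rewrite /q /mixture /=.
  rewrite -ge0_sume_distrl; last by move=> b _; rewrite lee_fin weight_ge0.
  rewrite sumEFin -L_sum L_flow -ge0_muleDl ?lee_fin ?subr_ge0 ?(ltW (L_gt0 _))//.
  rewrite -EFinD addrC subrK -!EFinM; congr EFin.
  have [s0|s0] := leP 0%R s; last by rewrite !decay0// mulr0 mul0r.
  rewrite !decayE// mulrCA -!mulrA -!expRD; congr (_ * expR _)%R; ring.
rewrite ge0_integralZl//.
- rewrite (_ : B * _ = B / (B + 1) * expR (- y.1.1) * (B + 1))%R; last first.
    by rewrite mulrAC divfK// gt_eqF.
  by rewrite EFinM -muleA integral_decay// mule1.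
- by apply/measurable_EFinP; exact: measurable_decay.
- by move=> s _; rewrite lee_fin decay_ge0.
- by rewrite lee_fin mulr_ge0// ltW.
Qed.

Lemma iter_step_unif_expR m y :
  iter m (step tau unif_branches) (fun z => (expR (- z.1.1))%:E) y =
  ((B / (B + 1)) ^+ m * expR (- y.1.1))%:E.
Proof.
elim: m y => [|m IH] y; first by rewrite /= expr0 mul1r.
have B1 : (0 < B + 1)%R by rewrite addr_gt0.
have me : measurable_fun [set: Y] (fun z => (expR (- z.1.1))%:E).
  apply/measurable_EFinP; apply: measurableT_comp => //.
  by do 2 apply: measurableT_comp => //.
rewrite iterS.
transitivity (step tau unif_branches (fun z : Y =>
   ((B / (B + 1)) ^+ m)%:E * (expR (- z.1.1))%:E) y).
  by apply: eq_kint => u; rewrite IH.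
rewrite /step kintZ.
- rewrite -/(step tau unif_branches (fun z => (expR (- z.1.1))%:E) y).
  by rewrite step_unif_expR -EFinM mulrA -exprSr.
- exact: (measurableT_comp me (measurable_advance_slice y)).
- by move=> u; rewrite lee_fin expR_ge0.
- by rewrite exprn_ge0// divr_ge0// ltW.
Qed.

Variable A : set (n.-tuple S).
Hypothesis mA : measurable A.

Let F0 : Y -> \bar R := EFin \o \1_(all_observed tau A).
Let F0_ge0 y : 0 <= F0 y. Proof. by rewrite /F0/= lee_fin. Qed.
Let mF0 : measurable_fun [set: Y] F0.
Proof. by apply/measurable_EFinP; apply: measurable_indic; exact: measurable_all_observed. Qed.

(** A complete record survives every further epoch, and the kernel of one epoch has total mass 1. *)
Lemma le_step_observed y : F0 y <= step tau jump_branches F0 y.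
Proof.
have [[yr Ay]|yA] := pselect (all_observed tau A y); last first.
  rewrite {1}/F0 /comp indicE memNset//; exact: step_ge0.
rewrite {1}/F0 /comp indicE mem_set// step_jump//.
(* The value 1 of [F0 y] is written as the total mass of the waiting-time density, to be compared
   pointwise in [s]. *)
rewrite -(integral_decay (L_gt0 y.1.2)) -ge0_integralZl//; last 3 first.
- by apply/measurable_EFinP; exact: measurable_decay.
- by move=> s _; rewrite lee_fin decay_ge0.
- by rewrite lee_fin ltW.
apply: ge0_le_integral => //.
- by move=> s _; rewrite -EFinM lee_fin mulr_ge0 ?decay_ge0// ltW.
- apply: emeasurable_funM => //.
  by apply/measurable_EFinP; exact: measurable_decay.
- apply: emeasurable_funM; first by apply/measurable_EFinP; exact: measurable_decay.
  exact: measurable_q.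
move=> s _; have [s0|s0] := leP 0%R s; last by rewrite decay0// !mul0e mule0.
rewrite muleC; apply: lee_wpmul2l; first by rewrite lee_fin decay_ge0.
rewrite -(L_flow _ s) L_sum -sumEFin; apply: lee_sum => b _.
rewrite /F0 /comp indicE mem_set ?mule1//; split => /= [k|].
  by rewrite (lt_le_trans (yr k))// lerDl.
congr A : Ay; apply: eq_from_tnth => k; rewrite tnth_mktuple.
by rewrite leNgt yr.
Qed.

Lemma le_iter_step_jump m y :
  iter m (step tau jump_branches) F0 y <= iter m.+1 (step tau jump_branches) F0 y.
Proof.
elim: m y => [|m IH] y; first exact: le_step_observed.
have m_step k : measurable_fun [set: Y] (fun z => iter k (step tau jump_branches) F0 z).
  exact: measurable_iter_step.
apply: le_kint => //.
- exact: (measurableT_comp (m_step m) (measurable_advance_slice y)).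
- exact: (measurableT_comp (m_step m.+1) (measurable_advance_slice y)).
- by move=> u; exact: iter_step_ge0.
- by move=> u; exact: IH.
Qed.

(** Induction on [m]: [step_unif_jump] splits a jump step like a uniformized step, except that a
    dummy epoch does not use up a jump. *)
Lemma le_iter_step_unif_jump m y :
  iter m (step tau unif_branches) F0 y <= iter m (step tau jump_branches) F0 y.
Proof.
elim: m y => [//|m IH] y.
have u0 z : 0 <= iter m (step tau unif_branches) F0 z by exact: iter_step_ge0.
have v0 k z : 0 <= iter k (step tau jump_branches) F0 z by exact: iter_step_ge0.
have mv k : measurable_fun [set: Y] (iter k (step tau jump_branches) F0).
  exact: measurable_iter_step.
have mu : measurable_fun [set: Y] (iter m (step tau unif_branches) F0).
  exact: measurable_iter_step.
have m_slice G : measurable_fun [set: Y] G -> measurable_fun [set: R]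
    (fun s => (B - L y.1.2)%:E * G (advance tau y (s, flow y.1.2 s))).
  move=> mG; apply: emeasurable_funM => //; apply: (measurableT_comp mG).
  apply: (measurableT_comp (measurable_advance_slice y)).
  by apply: measurable_fun_pair => //; exact: measurable_flow_slice.
have m_integrand G H : measurable_fun [set: Y] G -> measurable_fun [set: Y] H ->
    measurable_fun [set: R] (fun s => (decay B s)%:E * (q G y s +
      (B - L y.1.2)%:E * H (advance tau y (s, flow y.1.2 s)))).
  move=> mG mH; apply: emeasurable_funM.
    by apply/measurable_EFinP; exact: measurable_decay.
  by apply: emeasurable_funD; [exact: measurable_q|exact: m_slice].
have BL0 : 0 <= (B - L y.1.2)%:E by rewrite lee_fin subr_ge0.
rewrite -[leLHS]/(step _ _ (iter m _ F0) y) -[leRHS]/(step _ _ (iter m _ F0) y).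
rewrite step_unif// -step_unif_jump//.
apply: ge0_le_integral => //.
- move=> s _; rewrite mule_ge0 ?lee_fin ?decay_ge0//.
  by rewrite adde_ge0 ?q_ge0 ?mule_ge0.
- exact: m_integrand.
- exact: (m_integrand _ _ (mv m) (mv m.+1)).
move=> s _; apply: lee_wpmul2l; first by rewrite lee_fin decay_ge0.
apply: leeD; first by apply: le_mixture => z; exact: IH.
(* After a dummy epoch the jump side still has [m.+1] steps left against [m]; monotonicity in the
   number of steps covers the gap. *)
apply: lee_wpmul2l => //; exact: le_trans (IH _) (le_iter_step_jump _ _).
Qed.

End comparison.
End uniformization.

(** * The wireless sensor network *)

Section left_continuity.
Context (R : realType).

Lemma grid_interval (t : R) (n : nat) : 0 < t ->
  exists k : nat, t \in `](k%:R / n.+1%:R), (k.+1%:R / n.+1%:R)].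
Proof.
move=> t0; have n0 : 0 < n.+1%:R :> R by rewrite ltr0n.
have /ex_minnP[[|k] tk kmin] : exists m : nat, t * n.+1%:R <= m%:R.
  exists (Num.truncn (t * n.+1%:R)).+1; exact/ltW/truncnS_gt.
  by move: tk; rewrite leNgt mulr_gt0.
exists k; rewrite in_itv/= ltr_pdivrMr// ler_pdivlMr// tk andbT.
by rewrite ltNge; apply/negP => /kmin; rewrite ltnn.
Qed.

(** Membership of [t] in [A] can be read off, for all fine enough grids, at the grid point just left
    of [t]; so [A] is a lower limit of countable unions of intervals. *)
Lemma measurable_left_continuous (A : set R) :
  (forall t, 0 < t -> \forall s \near t^'-, A s <-> A t) ->
  measurable (`]0, +oo[ `&` A).
Proof.
move=> Alc.
pose J n k : set R :=
  [set t | t \in `](k%:R / n.+1%:R), (k.+1%:R / n.+1%:R)] /\ A (k%:R / n.+1%:R)].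
have mJ n k : measurable (J n k).
  have [Ak|nAk] := pselect (A (k%:R / n.+1%:R)).
    rewrite (_ : J n k = `](k%:R / n.+1%:R), (k.+1%:R / n.+1%:R)]%classic)//.
    by apply/seteqP; split => t //= [].
  by rewrite (_ : J n k = set0)//; apply/seteqP; split => t // -[].
(* The mesh [1 / n.+1] is below [e]. Cells are open on the left, so their left endpoint is strictly
   smaller than [t], as [t^'-] demands. *)
have close (t e : R) n k : 0 < e -> (Num.truncn e^-1 <= n)%N ->
    t \in `](k%:R / n.+1%:R), (k.+1%:R / n.+1%:R)] ->
    ball t e (k%:R / n.+1%:R : R) /\ k%:R / n.+1%:R < t.
  move=> e0 en; rewrite in_itv/= => /andP[kt tk]; split => //.
  have n0 : 0 < n.+1%:R :> R by rewrite ltr0n.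
  rewrite /ball/= ger0_norm ?subr_ge0 ?(ltW kt)//.
  rewrite ltrBlDr (le_lt_trans tk)// -natr1 mulrDl mul1r addrC ltrD2r.
  rewrite -[ltRHS]invrK ltf_pV2 ?posrE ?invr_gt0//.
  by rewrite (lt_le_trans (truncnS_gt _))// ler_nat.
rewrite (_ : _ `&` A = `]0, +oo[ `&`
    \bigcup_N \bigcap_(n in [set n | (N <= n)%N]) \bigcup_k J n k); last first.
  apply/seteqP; split => t /= [t0 tA]; split => //; move: (t0);
    rewrite in_itv/= andbT => t_gt0; have [e /= e0 et] := Alc t t_gt0.
  - exists (Num.truncn e^-1) => // n /= en; have [k tk] := grid_interval n t_gt0.
    have [kt kt'] := close _ _ _ _ e0 en tk.
    by exists k => //; split => //; exact/(et _ kt kt').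
  - case: tA => N _ tA.
    have [k _ [tk Ak]] := tA (maxn N (Num.truncn e^-1)) (leq_maxl _ _).
    have [kt kt'] := close _ _ _ _ e0 (leq_maxr _ _) tk.
    exact/(et _ kt kt').
apply: measurableI => //; apply: bigcupT_measurable => N.
apply: bigcap_measurable => [|n _]; first by exists N => /=.
exact: bigcupT_measurable.
Qed.

End left_continuity.

(** * The transitions of the two models as branches *)

Section model.
Context (R : realType).
Local Notation S := (state R).

Lemma measurable_queue (A : set (nat * nat)) : measurable A.
Proof.
apply: countable_measurable => [[i j]|]; last exact: countableP.
rewrite (_ : [set _] = [set i] `*` [set j]); first exact: measurableX.
by apply/seteqP; split => [_ ->//|[k l] /= [-> ->]].
Qed.

(* Left continuity says nothing about negative ages, where [pi] need not be
   measurable. *)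
Definition clip (pi : policy R) : policy R := fun x => if 0 <= x.2 then pi x else DB.

(** The set is a countable union over the pairs [(i, j)]. Age 0 is split off, as left continuity
    imposes nothing there. *)
Lemma measurable_clip (pi : policy R) : left_continuous pi ->
  measurable [set x | clip pi x = WSN].
Proof.
move=> pilc; pose A (ij : nat * nat) := [set t : R | pi (ij, t) = WSN].
have -> : [set x | clip pi x = WSN] =
    \bigcup_ij ([set ij] `*` ((`]0, +oo[ `&` A ij) `|` ([set 0] `&` A ij))).
  apply/seteqP; split => [[ij t]|[ij t] [ij' _ [/= <-]]].
    rewrite /clip /=; case: ifPn => // t0 piW; exists ij => //; split => //=.
    move: t0; rewrite le_eqVlt => /predU1P[t0|t0]; [right|left]; split => //=.
    by rewrite in_itv/= t0.
  rewrite /clip/= in_itv/= andbT => -[[t0 At]|[-> At]].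
    by rewrite (ltW t0).
  by rewrite lexx.
apply: countable_bigcupT_measurable => [|ij]; first exact: countableP.
apply: measurableX; first exact: measurable_queue.
apply: measurableU.
  apply: measurable_left_continuous => t t0; case: ij @A => i j A.
  by have := pilc i j t t0; apply: filterS => s /= st; rewrite /A/= st.
have [A0|nA0] := pselect (A ij 0).
  by rewrite (_ : _ `&` _ = [set 0])//; apply/seteqP; split => t //= => [[]|->].
by rewrite (_ : _ `&` _ = set0)//; apply/seteqP; split => t //= [->].
Qed.

Lemma measurable_queue_fun d (T : measurableType d) (f : nat * nat -> T) :
  measurable_fun [set: S] (fun x => f x.1).
Proof.
apply: (@measurableT_comp _ _ _ _ _ _ f) => // _ B _.
apply: countable_measurable => [ij|]; first exact: measurable_queue.
exact: countableP.
Qed.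

Lemma measurable_move (f : nat * nat -> nat * nat) :
  measurable_fun [set: S] (fun x => (f x.1, x.2)).
Proof. by apply: measurable_fun_pair => //; exact: measurable_queue_fun. Qed.

Lemma measurable_move_reset (f : nat * nat -> nat * nat) :
  measurable_fun [set: S] (fun x => (f x.1, 0 : R)).
Proof. by apply: measurable_fun_pair => //; exact: measurable_queue_fun. Qed.

Variables (lambda1 lambda2 mu B : R).
Hypotheses (lambda1_gt0 : 0 < lambda1) (lambda2_gt0 : 0 < lambda2) (mu_gt0 : 0 < mu)
  (B_ge : lambda1 + lambda2 + mu <= B).
Variable pi : policy R.
Hypothesis mpi : measurable [set x | pi x = WSN].

Let wsn (x : S) : bool := if pi x is WSN then true else false.

Let measurable_wsn : measurable_fun [set: S] wsn.
Proof.
apply: (measurable_fun_bool true); rewrite setTI.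
rewrite (_ : _ @^-1` _ = [set x | pi x = WSN])//.
by apply/seteqP; split => x /=; rewrite /wsn; case: (pi x).
Qed.

Let wsn_weight_ge0 x : 0 <= (if pi x is WSN then lambda1 else 0).
Proof. by case: (pi x) => //; exact: ltW. Qed.
Let db_weight_ge0 x : 0 <= (if pi x is DB then lambda1 else 0).
Proof. by case: (pi x) => //; exact: ltW. Qed.
Let measurable_wsn_weight :
  measurable_fun [set: S] (fun x => (if pi x is WSN then lambda1 else 0) : R).
Proof.
rewrite (_ : (fun _ => _) = fun x => (if wsn x then lambda1 else 0) : R); last first.
  by apply/funext => x; rewrite /wsn; case: (pi x).
exact: measurable_fun_ifT.
Qed.
Let measurable_db_weight :
  measurable_fun [set: S] (fun x => (if pi x is DB then lambda1 else 0) : R).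
Proof.
rewrite (_ : (fun _ => _) = fun x => (if wsn x then 0 else lambda1) : R); last first.
  by apply/funext => x; rewrite /wsn; case: (pi x).
exact: measurable_fun_ifT.
Qed.

Let service1 (ij : nat * nat) : R := if (0 < ij.1)%N then mu * phi1 ij.1 ij.2 else 0.
Let service2 (ij : nat * nat) : R := if (0 < ij.2)%N then mu * phi2 ij.1 ij.2 else 0.
Let service1_ge0 (x : S) : 0 <= service1 x.1.
Proof. by rewrite /service1; case: ifP => // _; rewrite mulr_ge0 ?divr_ge0 ?ler0n// ltW. Qed.
Let service2_ge0 (x : S) : 0 <= service2 x.1.
Proof. by rewrite /service2; case: ifP => // _; rewrite mulr_ge0 ?divr_ge0 ?ler0n// ltW. Qed.

Definition ctmdp_branches : seq (@branch _ S _ S R) :=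
  [:: Branch wsn_weight_ge0 measurable_wsn_weight
        (measurable_move (fun ij => (ij.1.+1, ij.2)));
      Branch db_weight_ge0 measurable_db_weight (measurable_move id);
      Branch (fun=> ltW lambda2_gt0) (@measurable_cst _ _ S R setT lambda2)
        (measurable_move (fun ij => (ij.1, ij.2.+1)));
      Branch service1_ge0 (measurable_queue_fun service1)
        (measurable_move (fun ij => (ij.1.-1, ij.2)));
      Branch service2_ge0 (measurable_queue_fun service2)
        (measurable_move_reset (fun ij => (ij.1, ij.2.-1)))].

Lemma ctmdp_ratesE x : ctmdp_rates lambda1 lambda2 mu pi x =
  [seq (weight b x, target b x) | b <- ctmdp_branches].
Proof. by case: x => [[i j] t]. Qed.

(** Since a query sent to the DB counts as a transition, neither the action nor the age enters; the
    total rate is thus constant along the drift. *)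
Definition total (x : S) : R :=
  lambda1 + lambda2 + (if (0 < x.1.1 + x.1.2)%N then mu else 0).

Lemma measurable_total : measurable_fun [set: S] total.
Proof.
exact: (measurable_queue_fun
  (fun ij => lambda1 + lambda2 + (if (0 < ij.1 + ij.2)%N then mu else 0))).
Qed.

Lemma total_gt0 x : 0 < total x.
Proof. by rewrite /total; case: ifP => _; rewrite ?addr0 !addr_gt0. Qed.

Lemma total_le x : total x <= B.
Proof.
apply: le_trans B_ge; rewrite lerD2l; case: ifP => // _; exact: ltW.
Qed.

(** Exactly one of the two query branches is active, and the processor shares add up to 1 unless the
    system is empty. *)
Lemma total_sum x : total x = \sum_(b <- ctmdp_branches) weight b x.
Proof.
rewrite /ctmdp_branches !big_cons big_nil /=; case: x => [[i j] t].
rewrite /total /service1 /service2 /phi1 /phi2 /=.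
have -> : (if pi (i, j, t) is WSN then lambda1 else 0) +
  ((if pi (i, j, t) is DB then lambda1 else 0) +
   (lambda2 + ((if (0 < i)%N then mu * (i%:R / (i + j)%:R) else 0) +
   ((if (0 < j)%N then mu * (j%:R / (i + j)%:R) else 0) + 0)))) =
  lambda1 + lambda2 + ((if (0 < i)%N then mu * (i%:R / (i + j)%:R) else 0) +
   (if (0 < j)%N then mu * (j%:R / (i + j)%:R) else 0)).
  by case: (pi _); ring.
congr (_ + _).
case: i => [|i]; case: j => [|j]; rewrite /= ?addn0 ?add0n ?addr0 ?add0r//=.
- by rewrite divff ?mulr1// pnatr_eq0.
- by rewrite divff ?mulr1// pnatr_eq0.
- by rewrite -mulrDr -mulrDl -natrD divff ?mulr1// pnatr_eq0.
Qed.

Local Notation leb := (@lebesgue_measure R).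

Lemma mass_mixture (bs : seq (@branch _ S _ S R)) (C : set (R * S)) (s : R) x :
  (mass [seq (weight b x, target b x) | b <- bs] [set y | C (s, y)])%:E =
  mixture bs (fun y => (EFin \o \1_C) (s, y)) x.
Proof.
rewrite /mass /mixture big_map -sumEFin; apply: eq_bigr => b _ /=.
by rewrite EFinM.
Qed.

(** The rate being constant along the drift, its integral over [[0, s]] is [total x * s], so the
    survival function is a [decay]. *)
Lemma ctmdp_kint x C : ctmdp lambda1 lambda2 mu pi x C =
  kint (jump_branches ctmdp_branches measurable_total) (EFin \o \1_C) x.
Proof.
rewrite /ctmdp /rate_kernel /kint integral_mkcond.
apply: eq_integral => s _; rewrite /jump_branches mixture_timed; last first.
  by move=> u; rewrite /= lee_fin.
rewrite patchE; have [s0|s0] := leP 0 s; last first.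
  by rewrite decay0// mul0e memNset//= in_itv/= andbT leNgt s0.
rewrite mem_set; last by rewrite /= in_itv/= s0.
rewrite EFinM ctmdp_ratesE mass_mixture decayE//; congr (_%:E * _)%E.
congr (expR (- _)); rewrite /Rintegral.
rewrite (_ : integral _ _ _ = \int[leb]_(u in `[0%R, s]) (total x)%:E)%E; last first.
  apply: eq_integral => u _; congr EFin.
  by rewrite ctmdp_ratesE /total_rate big_map -total_sum.
by rewrite integral_cst//= lebesgue_measure_itv/= lte_fin; case: ltgtP s0 => // [s0|<-] _;
  rewrite ?mule0 ?mulr0// -EFinD subr0.
Qed.

Let B_gt0 : 0 < B. Proof. by rewrite (lt_le_trans _ B_ge)// !addr_gt0. Qed.

(** The factor [B] of the exponential density turns probabilities into rates, that of the dummy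
    transition into [B - total x]. *)
Lemma mass_unif_probs x A : B * mass (unif_probs lambda1 lambda2 mu B pi x) A =
  mass [seq (weight b x, target b x) |
         b <- dummy measurable_total total_le :: ctmdp_branches] A.
Proof.
have B0 : B != 0 by rewrite gt_eqF.
case: x => [[i j] t]; rewrite /mass /unif_probs /ctmdp_branches /= !big_cons big_nil /=.
rewrite /service1 /service2 /total /=.
by case: (pi _); case: ifP => _; case: ifP => _; case: ifP => _; field.
Qed.

Lemma unif_kint x C : measurable C -> uniformized_mdp lambda1 lambda2 mu B pi x C =
  kint (unif_branches ctmdp_branches measurable_total total_le) (EFin \o \1_C) x.
Proof.
move=> mC; pose nu : {measure set (measurableTypeR R) -> \bar R} := exponential_prob B.
pose g s := (mass (unif_probs lambda1 lambda2 mu B pi (flow x s)) [set y | C (s, y)])%:E.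
(* With the identity as target, a one-branch mixture over Lebesgue measure says that
   [exponential_prob B] has density [exponential_pdf B]. *)
pose pdf : @branch _ (measurableTypeR R) _ (measurableTypeR R) R :=
  @Branch _ (measurableTypeR R) _ (measurableTypeR R) R (exponential_pdf B) id
    (exponential_pdf_ge0 (ltW B_gt0)) (measurable_exponential_pdf B)
    (@measurable_id _ _ _).
have gE s : (B%:E * g s)%E =
    mixture (dummy measurable_total total_le :: ctmdp_branches)
      (fun y => (EFin \o \1_C) (s, y)) (flow x s).
  by rewrite -EFinM mass_unif_probs mass_mixture.
have g_ge0 s : (0 <= g s)%E.
  rewrite -(@pmule_rge0 _ B%:E) ?lte_fin// gE; apply: mixture_ge0 => y.
  by rewrite /= lee_fin.
have mg : measurable_fun [set: R] g.
  rewrite (_ : g = fun s => B^-1%:E * (B%:E * g s))%E; last first.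
    by apply/funext => s; rewrite muleA -EFinM mulVf ?mul1r// gt_eqF.
  apply: measurable_funeM; under eq_fun do rewrite gE.
  apply: (measurable_mixture_flow _ _ (f := EFin \o \1_C)).
  by apply/measurable_EFinP; exact: measurable_indic.
rewrite /uniformized_mdp integral_mkcond -/g.
rewrite [LHS](@ge0_integral_mixture _ _ _ _ _ leb (nu B_gt0) [:: pdf])//.
- apply: eq_integral => s _; rewrite /unif_branches mixture_timed; last first.
    by move=> u; rewrite /= lee_fin.
  rewrite -gE [LHS]big_seq1 /= exponential_pdf_decay patchE.
  have [s0|s0] := leP 0 s; last by rewrite decay0// mulr0 !mul0e.
  rewrite mem_set; last by rewrite /= in_itv/= s0.
  by rewrite EFinM [RHS]muleA; congr (_ * _)%E; rewrite muleC.
- move=> D mD; rewrite /nu /= /exponential_prob integral_mkcond.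
  apply: eq_integral => s _; rewrite patchE /mixture big_seq1 /= indicE.
  by case: ifPn => _; rewrite ?mule1 ?mule0.
- exact/(measurable_restrictT _ _).1/measurable_funTS.
- by move=> s; apply: erestrict_ge0 => u _.
Qed.

End model.

(** * Equality of the finite-dimensional laws *)

Section equivalence.
Context (R : realType) (lambda1 lambda2 mu B : R).
Hypotheses (lambda1_gt0 : 0 < lambda1) (lambda2_gt0 : 0 < lambda2) (mu_gt0 : 0 < mu)
  (B_ge : lambda1 + lambda2 + mu <= B).
Variable pi : policy R.
Hypothesis pi_lc : left_continuous pi.
Local Notation S := (state R).

Lemma clipE (x : S) : in_S x -> clip pi x = pi x.
Proof. by rewrite /clip => ->. Qed.

Lemma in_S_flow (x : S) s : in_S x -> 0 <= s -> in_S (flow x s).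
Proof. exact: addr_ge0. Qed.

(** From a nonnegative age the drift meets only nonnegative ages, where clipping changes nothing. *)
Lemma ctmdp_clip x C : in_S x ->
  ctmdp lambda1 lambda2 mu pi x C = ctmdp lambda1 lambda2 mu (clip pi) x C.
Proof.
move=> xS; have ratesE y : in_S y ->
    ctmdp_rates lambda1 lambda2 mu pi y = ctmdp_rates lambda1 lambda2 mu (clip pi) y.
  by move=> /clipE; case: y => [[i j] t] /= ->.
apply: eq_integral => s /set_mem s_ge0.
have {s_ge0}s0 : 0 <= s by move: s_ge0; rewrite /= in_itv/= andbT.
rewrite -ratesE; last exact: in_S_flow.
congr (expR (- _) * _)%:E; congr fine; apply: eq_integral => u /set_mem us.
have {us}u0 : 0 <= u by move: us; rewrite /= in_itv/= => /andP[].
by rewrite -ratesE//; exact: in_S_flow.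
Qed.

Lemma unif_clip x C : in_S x ->
  uniformized_mdp lambda1 lambda2 mu B pi x C =
  uniformized_mdp lambda1 lambda2 mu B (clip pi) x C.
Proof.
move=> xS; have B_gt0 : 0 < B by rewrite (lt_le_trans _ B_ge)// !addr_gt0.
pose nu : {measure set (measurableTypeR R) -> \bar R} := exponential_prob B.
rewrite /uniformized_mdp -[exponential_prob B]/(nu B_gt0 : set _ -> \bar R).
apply: eq_integral => s /set_mem s_ge0.
have {s_ge0}s0 : 0 <= s by move: s_ge0; rewrite /= in_itv/= andbT.
have := clipE (in_S_flow xS s0); case: (flow x s) => [[i j] t].
by rewrite /unif_probs => ->.
Qed.

Lemma measurable_fdd_event n (t : n.-tuple R) (A : set (n.-tuple S)) K (x : S)
    d (W : measurableType d) (P : probability W R) (X : R -> W -> S) :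
  measurable A -> (forall k, 0 <= tnth t k) -> is_process K x P X ->
  measurable ((fun w => [tuple X (tnth t k) w | k < n]) @^-1` A).
Proof.
move=> mA t0 [T [Z [_ _ _ _ XE]]].
have mX : measurable_fun [set: W] (fun w => [tuple X (tnth t k) w | k < n]).
  apply/measurable_fun_tnthP => k.
  rewrite (_ : _ \o _ = X (tnth t k)); first by case: (XE _ (t0 k)).
  by apply/funext => w /=; rewrite tnth_mktuple.
by rewrite -[X in measurable X]setTI; exact: mX.
Qed.

(** Paths whose record is complete after [m] epochs are handled by the operator comparison; by
    Markov's inequality for [exp(-S_m)] the others have probability at most [expR T * rho ^+ m],
    which tends to 0. *)
Lemma le_fdd n (t : n.-tuple R) (x : S) (A : set (n.-tuple S))
    d1 (W1 : measurableType d1) (P1 : probability W1 R) (X1 : R -> W1 -> S)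
    d2 (W2 : measurableType d2) (P2 : probability W2 R) (X2 : R -> W2 -> S) :
  in_S x -> (forall k, 0 <= tnth t k) -> measurable A ->
  is_process (uniformized_mdp lambda1 lambda2 mu B pi) x P1 X1 ->
  is_process (ctmdp lambda1 lambda2 mu pi) x P2 X2 ->
  (P1 ((fun w => [tuple X1 (tnth t k) w | k < n]) @^-1` A) <=
   P2 ((fun w => [tuple X2 (tnth t k) w | k < n]) @^-1` A))%E.
Proof.
move=> xS t0 mA proc1 proc2; have mpi := measurable_clip pi_lc.
pose rs := ctmdp_branches lambda1_gt0 lambda2_gt0 mu_gt0 mpi.
pose mL := measurable_total lambda1 lambda2 mu.
pose L_le := total_le mu_gt0 B_ge.
pose us := unif_branches rs mL L_le.
pose js := jump_branches rs mL.
have mX1 := measurable_fdd_event mA t0 proc1.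
have mX2 := measurable_fdd_event mA t0 proc2.
have [Q1 [mQ1 Q1E Q1X]] := @process_observation _ _ t us _ _ _ _ _ _ t0
  (fun y yS C mC => etrans (unif_clip C yS) (unif_kint _ _ _ _ _ _ mC)) proc1.
have [Q2 [mQ2 Q2E Q2X]] := @process_observation _ _ t js _ _ _ _ _ _ t0
  (fun y yS C mC => etrans (ctmdp_clip C yS) (ctmdp_kint _ _ _ _ _ _)) proc2.
pose F0 : _ -> \bar R := EFin \o \1_(all_observed t A).
have F0_ge0 y : (0 <= F0 y)%E by rewrite /F0/= lee_fin.
have mF0 : measurable_fun setT F0.
  by apply/measurable_EFinP; apply: measurable_indic; exact: measurable_all_observed.
have observedX (W : Type) (X : R -> W -> S) (Q : nat -> W -> R * S * n.-tuple S) m w :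
    (forall m w k, tnth t k < (Q m w).1.1 -> tnth (Q m w).2 k = X (tnth t k) w) ->
    (forall k, tnth t k < (Q m w).1.1) ->
    (Q m w).2 = [tuple X (tnth t k) w | k < n].
  by move=> QX obs; apply: eq_from_tnth => k; rewrite tnth_mktuple QX.
pose rho := B / (B + 1).
(* The sum of the nonnegative times bounds each of them, and also makes sense for [n = 0]. *)
pose T := \sum_(k < n) tnth t k.
have T_ge m w : ~ (forall k, tnth t k < (Q1 m w).1.1) -> (Q1 m w).1.1 <= T.
  move=> /existsNP[k /negP]; rewrite -leNgt => /le_trans; apply.
  by rewrite /T (bigD1 k)//= lerDl sumr_ge0.
have mexp : measurable_fun setT
    (fun z : R * S * n.-tuple S => (expR (- z.1.1))%:E).
  apply/measurable_EFinP; apply: measurableT_comp => //.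
  by do 2 apply: measurableT_comp => //.
have le_m m : (P1 ((fun w => [tuple X1 (tnth t k) w | k < n]) @^-1` A) <=
   P2 ((fun w => [tuple X2 (tnth t k) w | k < n]) @^-1` A) +
   (expR T * rho ^+ m)%:E)%E.
  apply: (@le_trans _ _ (iter m (step t us) F0 (start n x) +
      (expR T)%:E * iter m (step t us) (fun z => (expR (- z.1.1))%:E) (start n x))%E).
    rewrite -!Q1E//.
    have mF0Q : measurable_fun [set: W1] (fun w => F0 (Q1 m w)).
      exact: (measurableT_comp mF0 (mQ1 m)).
    have mexpQ : measurable_fun [set: W1] (fun w => (expR (- (Q1 m w).1.1))%:E).
      exact: (measurableT_comp mexp (mQ1 m)).
    rewrite -ge0_integralZl// -ge0_integralD//; last exact: measurable_funeM.
    rewrite -[X in P1 X]setIT -integral_indic//; apply: ge0_le_integral => //.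
    - by apply/measurable_EFinP; exact: measurable_indic.
    - by apply: emeasurable_funD => //; exact: measurable_funeM.
    have sum_ge0 w : (0 <= F0 (Q1 m w) + (expR T)%:E * (expR (- (Q1 m w).1.1))%:E)%E.
      by rewrite adde_ge0// mule_ge0// lee_fin expR_ge0.
    move=> w _; rewrite indicE.
    have [|_] := boolP (w \in _); last exact: sum_ge0.
    rewrite inE/= => Aw.
    have [obs|nobs] := pselect (forall k, tnth t k < (Q1 m w).1.1).
      rewrite {1}/F0 /comp indicE mem_set ?leeDl ?mule_ge0 ?lee_fin ?expR_ge0//.
      by split => //=; rewrite (observedX _ _ _ _ _ Q1X).
    apply: (@le_trans _ _ ((expR T)%:E * (expR (- (Q1 m w).1.1))%:E)%E); last first.
      exact: leeDr.
    by rewrite -EFinM lee_fin -expRD -expR0 ler_expR subr_ge0; exact: T_ge.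
  apply: leeD.
    apply: (@le_trans _ _ (iter m (step t js) F0 (start n x))).
      apply: le_iter_step_unif_jump => //.
      - exact: total_gt0.
      - exact: total_sum.
    rewrite -Q2E// -[X in P2 X]setIT -integral_indic//.
    apply: ge0_le_integral => //.
    - exact: (measurableT_comp mF0 (mQ2 m)).
    - by apply/measurable_EFinP; exact: measurable_indic.
    move=> w _; rewrite /F0 /comp !indicE.
    have [|_] := boolP (Q2 m w \in _); last by rewrite lee_fin.
    rewrite inE => -[obs /=]; rewrite (observedX _ _ _ _ _ Q2X)// => Aw.
    by rewrite mem_set.
  rewrite (iter_step_unif_expR mL (total_gt0 lambda1_gt0 lambda2_gt0 mu_gt0) L_le)//.
    by rewrite /start/= oppr0 expR0 mulr1 -EFinM.
  exact: total_sum.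
apply/lee_addgt0Pr => e e0.
have rho01 : `|rho| < 1.
  have B_gt0 : 0 < B by rewrite (lt_le_trans _ B_ge)// !addr_gt0.
  have B1_gt0 : 0 < B + 1 by rewrite addr_gt0.
  by rewrite ger0_norm ?divr_ge0 ?(ltW B_gt0) ?(ltW B1_gt0)// ltr_pdivrMr// mul1r ltrDl.
have : (fun m => expR T * rho ^+ m) @ \oo --> (0 : R).
  rewrite -[X in _ --> X](mulr0 (expR T)); apply: cvgM; first exact: cvg_cst.
  exact: cvg_expr.
move=> /cvgrPdist_lt /(_ e e0) [m _ /(_ m (leqnn m))] /=.
rewrite sub0r normrN => /ltW em; apply: (le_trans (le_m m)).
by rewrite leeD2l// lee_fin (le_trans (ler_norm _)).
Qed.

End equivalence.

Theorem theorem1 (R : realType) (lambda1 lambda2 mu B : R)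
    (lambda1_gt0 : 0 < lambda1) (lambda2_gt0 : 0 < lambda2) (mu_gt0 : 0 < mu)
    (lambda2_lt_mu : lambda2 < mu) (B_ge : lambda1 + lambda2 + mu <= B)
    (pi : policy R) (pi_lc : left_continuous pi) :
  stochastically_equivalent
    (uniformized_mdp lambda1 lambda2 mu B pi)
    (ctmdp lambda1 lambda2 mu pi).
Proof.
move=> x xS d1 W1 P1 X1 d2 W2 P2 X2 proc1 proc2 n t t0 A mA.
set f1 := fun w => [tuple X1 (tnth t k) w | k < n].
set f2 := fun w => [tuple X2 (tnth t k) w | k < n].
have le_P C : measurable C -> (P1 (f1 @^-1` C) <= P2 (f2 @^-1` C))%E.
  by move=> mC; exact: (le_fdd lambda1_gt0 lambda2_gt0 mu_gt0 B_ge pi_lc xS t0 mC proc1 proc2).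
have mX1 : measurable (f1 @^-1` A) := measurable_fdd_event mA t0 proc1.
have mX2 : measurable (f2 @^-1` A) := measurable_fdd_event mA t0 proc2.
(* Domination on the complement of [A] is the reverse inequality on [A], both total masses being
   1. *)
have : (P1 (~` (f1 @^-1` A)) <= P2 (~` (f2 @^-1` A)))%E := le_P _ (measurableC mA).
rewrite (probability_setC P1 mX1) (probability_setC P2 mX2).
have := le_P _ mA; rewrite /pushforward.
rewrite -(fineK (fin_num_measure P1 _ mX1)) -(fineK (fin_num_measure P2 _ mX2)).
rewrite -!EFinB !lee_fin lerD2l lerN2 => le12 le21.
by congr EFin; apply/le_anti; rewrite le12 le21.
Qed.
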